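(* Let $G$ be a connected graph with $n$ vertices, girth $g(G)\geq 5$ and minimum degree $\delta(G)\geq 2$. Then $\gamma_t(G) \leq n-\left\lceil\frac{g(G)}{2}\right\rceil+1$.
   Context: Graphs are finite, simple and undirected. A set $S$ of vertices in a graph $G=(V,E)$ is called a total dominating set if every vertex $v\in V$ (including those in $S$) is adjacent to some element of $S$. The total domination number $\gamma_t(G)$ is the minimum cardinality of a total dominating set of $G$. The girth $g(G)$ is the length of a shortest cycle of $G$ (it is finite here, since $\delta(G)\ge 2$ forces $G$ to contain a cycle). *)

(* Defs.v *)
From mathcomp Require Import all_boot.

Set Implicit Arguments.
Unset Strict Implicit.
Unset Printing Implicit Defensive.

(* A finite simple graph is a finite vertex type T with a symmetric and
   irreflexive adjacency relation e : rel T.                                  *)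

Definition simple_graph (T : finType) (e : rel T) : Prop :=
  symmetric e /\ irreflexive e.

(* The null graph is not regarded as connected. *)
Definition connected_graph (T : finType) (e : rel T) : Prop :=
  0 < #|T| /\ forall x y : T, connect e x y.

Definition degree (T : finType) (e : rel T) (x : T) : nat :=
  #|[set y | e x y]|.

(* Degrees are at most #|T|, so the default value #|T| does not affect the
   minimum of a nonempty family.                                              *)
Definition min_degree (T : finType) (e : rel T) : nat :=
  \big[minn/#|T|]_(x : T) degree e x.

Definition has_cycle (T : finType) (e : rel T) (k : nat) : bool :=
  (2 < k) && [exists p : k.-tuple T, cycle e p && uniq p].

(* The least k such that there is a cycle of length k; a cycle has at most #|T|
   vertices. For an acyclic graph the value is #|T|.+1, standing for
   infinity.                                                                  *)
Definition girth (T : finType) (e : rel T) : nat :=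
  find (has_cycle e) (iota 0 #|T|.+1).

Definition total_dominating (T : finType) (e : rel T) (S : {set T}) : bool :=
  [forall v, exists u in S, e v u].

(* As #|S| <= #|T| always, the default value #|T| matters only if there is no
   total dominating set, i.e. if some vertex is isolated.                     *)
Definition total_domination_number (T : finType) (e : rel T) : nat :=
  \big[minn/#|T|]_(S : {set T} | total_dominating e S) #|S|.

Lemma has_cycle_leq (T : finType) (e : rel T) (k : nat) :
  has_cycle e k -> k <= #|T|.
Proof.
case/andP=> _ /existsP[p /andP[_ /card_uniqP]].
by rewrite size_tuple => <-; apply: max_card.
Qed.

Lemma girth_min (T : finType) (e : rel T) (k : nat) :
  has_cycle e k -> has_cycle e (girth e) /\ girth e <= k.
Proof.
move=> hk; have lk := has_cycle_leq hk.
have hh : has (has_cycle e) (iota 0 #|T|.+1).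
  by apply/hasP; exists k => //; rewrite mem_iota.
split.
  have := nth_find 0 hh; rewrite nth_iota //.
  by move: hh; rewrite has_find size_iota.
rewrite leqNgt; apply/negP => /(before_find 0).
by rewrite nth_iota // add0n hk.
Qed.

Lemma total_domination_numberP (T : finType) (e : rel T) :
  (forall x : T, exists y, e x y) ->
  (exists2 S : {set T}, total_dominating e S &
     #|S| = total_domination_number e) /\
  (forall S : {set T}, total_dominating e S ->
     total_domination_number e <= #|S|).
Proof.
move=> hT; have dT : total_dominating e [set: T].
  apply/forallP => v; have [u evu] := hT v.
  by apply/existsP; exists u; rewrite inE.
split=> [|S hS].
  rewrite /total_domination_number.
  elim/big_ind: _ => [|m n hm hn|S hS]; last by exists S.
    by exists [set: T]; rewrite ?cardsT.
  by rewrite /minn; case: ifP.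
rewrite /total_domination_number; have := mem_index_enum S.
elim: (index_enum _) => //= A r IHr; rewrite inE big_cons => /predU1P[<-|/IHr h].
  by rewrite hS geq_minl.
by case: ifP => // _; rewrite geq_min h orbT.
Qed.

(* Main.v *)
Require Import Defs.
From mathcomp Require Import all_boot.
From mathcomp Require Import zify.

Set Implicit Arguments.
Unset Strict Implicit.
Unset Printing Implicit Defensive.

(** Write [g] for the girth.  A set [D] has a total dominating complement as
    soon as no vertex has two distinct neighbours in [D], since every degree is
    at least 2.  So it suffices to find such a set [D] with at least
    [uphalf g - 1] elements.

    Since the degrees are at least 2, there is a cycle
    ([min_degree2_has_cycle]), hence one of length [g].  Remove two consecutive
    vertices from it to get a path [c_0, ..., c_(g-3)].  Dropping these two
    vertices leaves no wrap-around to deal with.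

    If a vertex [v] is adjacent to [c_i] and [c_j] with [i < j], then
    [j = i + 2].  Indeed, if [v] is off the path, then [v, c_i, ..., c_j]
    would be a cycle with at most [g - 1] vertices; and if [v] is on the path,
    then it has no chord to the path, which would also close a cycle that is
    too short, so that [c_i] and [c_j] are the two path neighbours of [v] ([common_neighbour_gap2]).

    Consequently [D] may consist of the [c_i] with [i] congruent to 0 or 1
    modulo 4: no two such indices differ by 2, and among [0, ..., g - 3] there
    are at least [uphalf (g - 2) = uphalf g - 1] of them
    ([count_mod4_lt2]). *)

Lemma has_cycle_size (T : finType) (e : rel T) (s : seq T) :
  cycle e s -> uniq s -> 2 < size s -> has_cycle e (size s).
Proof.
move=> cs us s3; rewrite /has_cycle s3; apply/existsP; exists (in_tuple s).
by rewrite /= cs us.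
Qed.

Lemma girth_leq_size (T : finType) (e : rel T) (s : seq T) :
  cycle e s -> uniq s -> 2 < size s -> girth e <= size s.
Proof. by move=> cs us s3; have [] := girth_min (has_cycle_size cs us s3). Qed.

Lemma min_degree_leq (T : finType) (e : rel T) (x : T) :
  min_degree e <= degree e x.
Proof.
rewrite /min_degree; have := mem_index_enum x.
elim: (index_enum _) => //= y r IHr; rewrite inE big_cons.
by case/predU1P=> [<-|/IHr h]; rewrite geq_min ?leqnn // h orbT.
Qed.

Lemma two_neighbours (T : finType) (e : rel T) (x : T) :
  2 <= min_degree e -> exists y z, [/\ y != z, e x y & e x z].
Proof.
move=> /leq_trans/(_ (min_degree_leq e x)); rewrite /degree.
by case/card_gt1P=> y [z []]; rewrite !inE => exy exz yz; exists y, z.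
Qed.

(** A path with a neighbour of its first vertex outside can be extended at that
    end; as the vertices of a path are distinct, this stops. *)
Lemma maximal_path (T : finType) (e : rel T) (x0 : T) : symmetric e ->
  exists x p, [/\ path e x p, uniq (x :: p) & forall y, e x y -> y \in x :: p].
Proof.
move=> esym.
suff ext n x p : path e x p -> uniq (x :: p) -> #|T| - size p <= n ->
    exists x p, [/\ path e x p, uniq (x :: p)
                  & forall y, e x y -> y \in x :: p].
  by apply: (ext #|T| x0 [::]) => //; rewrite subn0.
elim: n x p => [|n IHn] x p pp up sz.
  have: size (x :: p) <= #|T| by rewrite -(card_uniqP up) max_card.
  by move: sz; rewrite leqn0 subn_eq0 /= leqNgt => /negPf ->.
have [/forallP h|] := boolP [forall y, e x y ==> (y \in x :: p)].
  by exists x, p; split=> // y; apply/implyP/h.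
case/forallPn=> y; rewrite negb_imply => /andP[exy ynp].
apply: (IHn y (x :: p)); rewrite /= ?pp ?(esym y) ?exy //.
  by move: up ynp => /= -> ->.
by move: sz; rewrite /=; lia.
Qed.

(** The end of a maximal path has all its neighbours on the path, and only one
    of them can be the vertex next to it; any other one closes a cycle. *)
Lemma min_degree2_has_cycle (T : finType) (e : rel T) (x0 : T) :
  simple_graph e -> 2 <= min_degree e -> exists k, has_cycle e k.
Proof.
move=> [esym eirr] deg2.
have [x [p [pp up nbr]]] := maximal_path x0 esym.
have nbrp y : e x y -> y \in p.
  by move=> exy; have := nbr y exy; rewrite inE => /predU1P[yx|//];
     rewrite yx eirr in exy.
have [y [exy yh]] : exists y, e x y /\ y != head x p.
  have [y [z [yz exy exz]]] := two_neighbours x deg2.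
  have [yh|yh] := eqVneq y (head x p); last by exists y.
  by exists z; rewrite -yh eq_sym.
have yp := nbrp y exy.
move: pp up yh {nbr nbrp}; case/path.splitP: yp => p1 p2.
case: p1 => [|a p1]; first by rewrite /= eqxx.
rewrite cat_path -cat_cons cat_uniq => /andP[pp _] /andP[up _] _.
exists (size (x :: rcons (a :: p1) y)); apply: has_cycle_size => //.
  by rewrite [cycle _ _]rcons_path pp /= last_rcons esym.
by rewrite /= size_rcons.
Qed.

Lemma path_segment (T : eqType) (e : rel T) (x0 : T) (s : seq T) (i j : nat) :
    sorted e s -> uniq s -> i < j < size s ->
  exists p, [/\ path e (nth x0 s i) p, last (nth x0 s i) p = nth x0 s j,
    uniq (nth x0 s i :: p), {subset nth x0 s i :: p <= s} & size p = j - i].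
Proof.
move=> ss us /andP[ij js]; have si := ltn_trans ij js.
exists (take (j - i) (drop i.+1 s)).
have dE := drop_nth x0 si.
have tE : nth x0 s i :: take (j - i) (drop i.+1 s) = take (j - i).+1 (drop i s).
  by rewrite dE.
have sz : size (take (j - i) (drop i.+1 s)) = j - i.
  by rewrite size_take_min size_drop; lia.
split=> //.
- by have := take_sorted (j - i).+1 (drop_sorted i ss); rewrite -tE.
- rewrite (last_nth x0) sz tE nth_take // nth_drop; congr nth; lia.
- by rewrite tE take_uniq // drop_uniq.
- by move=> y; rewrite tE => /mem_take/mem_drop.
Qed.

(** A chord closes, with the segment of the path between its ends, a cycle with
    at most [size s] vertices. *)
Lemma short_path_chordless (T : finType) (e : rel T) (x0 : T) (s : seq T)
    (i j : nat) :
    symmetric e -> sorted e s -> uniq s -> size s < girth e ->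
    i < j < size s -> e (nth x0 s i) (nth x0 s j) ->
  j = i.+1.
Proof.
move=> esym ss us sg ijs eij.
have [p [pp lp up _ sp]] := path_segment x0 ss us ijs.
have [ji|ji] := leqP j i.+1; first by lia.
have: girth e <= size (nth x0 s i :: p).
  apply: girth_leq_size; rewrite /= ?sp //; last by lia.
  by rewrite rcons_path pp lp esym.
by rewrite /= sp; lia.
Qed.

(** Off the path, [v] closes the segment from [i] to [j] to a cycle with
    [j - i + 2 <= size s + 1] vertices, so this case is excluded by the bound on
    [size s].  On the path, [v] has no chord, so [i] and [j] are the indices
    just before and just after that of [v]. *)
Lemma common_neighbour_gap2 (T : finType) (e : rel T) (x0 v : T) (s : seq T)
    (i j : nat) :
    simple_graph e -> sorted e s -> uniq s -> size s + 2 <= girth e ->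
    i < j < size s -> e v (nth x0 s i) -> e v (nth x0 s j) ->
  j = i + 2.
Proof.
move=> [esym eirr] ss us sg ijs evi evj.
have [/(nthP x0)[k ks vE]|vs] := boolP (v \in s); last first.
  have [p [pp lp up sub sp]] := path_segment x0 ss us ijs.
  have: girth e <= size [:: v, nth x0 s i & p].
    apply: girth_leq_size; rewrite /= ?sp; last by lia.
      by rewrite evi rcons_path pp lp esym.
    by rewrite -[X in _ && X]/(uniq (_ :: p)) up andbT; apply: contra vs => /sub.
  by rewrite /= sp; lia.
have nbr l : l < size s -> e v (nth x0 s l) -> l = k.+1 \/ k = l.+1.
  move=> ls evl; have sg' : size s < girth e by lia.
  rewrite -vE in evl; case: (ltngtP k l) => [kl|lk|kl].
  - by left; apply: (short_path_chordless esym ss us sg' _ evl); rewrite kl.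
  - right; rewrite esym in evl.
    by apply: (short_path_chordless esym ss us sg' _ evl); rewrite lk.
  - by rewrite kl eirr in evl.
have is_ : i < size s by lia.
have js : j < size s by lia.
by have := nbr i is_ evi; have := nbr j js evj; lia.
Qed.

(** Each block of four consecutive indices contributes two, and in an incomplete
    last block the selected indices come first. *)
Lemma count_mod4_lt2 (m : nat) :
  uphalf m <= count (fun i => i %% 4 < 2) (iota 0 m).
Proof.
have [n] := ubnP m; elim: n m => // n IHn [|[|[|[|m]]]] // mn.
have -> : iota 0 m.+4 = [:: 0; 1; 2; 3] ++ [seq 4 + i | i <- iota 0 m].
  by rewrite -iotaDl.
rewrite count_cat count_map /= (@eq_count _ _ (fun i => i %% 4 < 2)).
  by have := IHn m; lia.
by move=> i; rewrite /= modnDl.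
Qed.

Lemma count_index (T : eqType) (a : pred nat) (s : seq T) :
  uniq s -> count (fun x => a (index x s)) s = count a (iota 0 (size s)).
Proof.
case: s => // x0 s' us; set s := x0 :: s' in us *.
rewrite -[X in count _ X](mkseq_nth x0 s) count_map; apply: eq_in_count => i.
by rewrite mem_iota => /andP[_ si]; apply: (congr1 a); apply: index_uniq.
Qed.

Lemma total_dominating_setC (T : finType) (e : rel T) (D : {set T}) :
    2 <= min_degree e ->
    (forall v x y, x \in D -> y \in D -> e v x -> e v y -> x = y) ->
  total_dominating e (~: D).
Proof.
move=> deg2 D1; apply/forallP=> v.
have [y [z [yz evy evz]]] := two_neighbours v deg2.
have [yD|yD] := boolP (y \in D); last first.
  by apply/existsP; exists y; rewrite inE yD.
have [zD|zD] := boolP (z \in D); last first.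
  by apply/existsP; exists z; rewrite inE zD.
by rewrite (D1 v y z) ?eqxx in yz.
Qed.

Theorem theorem3 (T : finType) (e : rel T)
  (hG : simple_graph e)
  (hconn : connected_graph e)
  (hgirth : 5 <= girth e)
  (hdeg : 2 <= min_degree e) :
  total_domination_number e <= #|T| - uphalf (girth e) + 1.
Proof.
have [/card_gt0P[x0 _] _] := hconn.
have [k /girth_min[/andP[_ /existsP[c /andP[cc uc]]] _]] :=
  min_degree2_has_cycle x0 hG hdeg.
set s := take (girth e - 2) c.
have us : uniq s by rewrite take_uniq.
have ss : sorted e s.
  by apply: take_sorted; case: (val c) cc => //= x p; rewrite rcons_path => /andP[].
have sz : size s = girth e - 2 by rewrite size_take_min size_tuple; lia.
pose D := [set x in [seq x <- s | index x s %% 4 < 2]].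
have cD : uphalf (girth e) - 1 <= #|D|.
  rewrite cardsE (card_uniqP (filter_uniq _ us)) size_filter.
  rewrite (count_index (fun i => i %% 4 < 2)) // sz.
  by have := count_mod4_lt2 (girth e - 2); lia.
have tD : total_dominating e (~: D).
  apply: total_dominating_setC => // v x y.
  rewrite !inE !mem_filter => /andP[xm xs] /andP[ym ys] evx evy.
  have gap i j := @common_neighbour_gap2 T e x0 v s i j hG ss us.
  have := gap (index x s) (index y s); have := gap (index y s) (index x s).
  rewrite !index_mem !nth_index // xs ys !andbT => gyx gxy.
  have sg : size s + 2 <= girth e by lia.
  (* Indices congruent to 0 or 1 modulo 4 never differ by 2. *)
  case: (ltngtP (index x s) (index y s)) => [xy|yx|/index_inj->//].
  - by have := gxy sg xy evx evy; lia.
  - by have := gyx sg yx evy evx; lia.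
have [|_ /(_ _ tD)] := @total_domination_numberP T e.
  by move=> x; have [y [_ [_ exy _]]] := two_neighbours x hdeg; exists y.
by have := cardsC D; lia.
Qed.
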